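(* Let $G$ be an infinite, locally finite, connected simple graph and let $a\in G$ be a fixed vertex. Then the space $\hat{\mathcal{L}}$ is complete with respect to the norm $\|\cdot\|_{\hat{\mathcal{L}}}^{a}$.
   Context: A graph is always connected, undirected, simple, with infinitely many vertices, each of finite degree; $G$ also denotes its vertex set, and $v\sim w$ means $v$ and $w$ are adjacent. The Lipschitz space is $\hat{\mathcal{L}}=\{f:G\to\mathbb{C} : \sup_{v\sim w}|f(v)-f(w)|<\infty\}$, where $\sup_{v\sim w}$ denotes the supremum over all adjacent pairs of vertices. For a fixed vertex $a$, $\|f\|_{\hat{\mathcal{L}}}^{a}:=|f(a)|+\sup_{v\sim w}|f(v)-f(w)|$ for $f\in\hat{\mathcal{L}}$; this is a norm on the complex vector space $\hat{\mathcal{L}}$. *)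

(* Defs.v *)
From HB Require Import structures.
From mathcomp Require Import all_boot all_order all_algebra.
From mathcomp Require Import all_classical all_reals all_analysis.
From mathcomp Require Export complex.

Set Implicit Arguments.
Unset Strict Implicit.
Unset Printing Implicit Defensive.

Import Order.TTheory GRing.Theory Num.Theory.
Import numFieldNormedType.Exports.
Import ComplexField.Normc.

Local Open Scope classical_set_scope.
Local Open Scope ring_scope.
Local Open Scope complex_scope.

Record graph := Graph {
  vertex :> Type;
  adj : rel vertex;
  adj_sym : symmetric adj;
  adj_irr : irreflexive adj;
  graph_connected : forall v w : vertex,
    exists2 s : seq vertex, path adj v s & last v s = w;
  graph_infinite : infinite_set [set: vertex];
  graph_locally_finite : forall v : vertex, finite_set [set w | adj v w] }.

Section Lipschitz.
Variables (R : realType) (G : graph).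
Implicit Types f g : G -> R[i].

(* [normc] is the modulus with values in [R]; the MathComp norm [`|z|] of
   [z : R[i]] is [(normc z)%:C]. *)
Definition edge_variation f : set R :=
  [set r | exists v w : G, adj v w /\ r = normc (f v - f w)].

Definition lipschitz : {pred G -> R[i]} :=
  [pred f : G -> R[i] | `[< has_ubound (edge_variation f) >]].

(* The set is bounded above on the Lipschitz space and nonempty since the graph
   is connected and infinite, so [sup] is a genuine supremum there. *)
Definition lip_norm (a : G) f : R := normc (f a) + sup (edge_variation f).

Lemma lipschitzP f :
  reflect (exists M : R, forall v w, adj v w -> normc (f v - f w) <= M)
          (f \in lipschitz).
Proof.
apply: (iffP (asboolP _)) => -[M fM]; exists M.
  by move=> v w vw; apply: fM; exists v, w.
by move=> _ [v [w [vw ->]]]; exact: fM.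
Qed.

Lemma normcZ (c : R[i]) f v w :
  normc ((c *: f) v - (c *: f) w) = normc c * normc (f v - f w).
Proof.
by rewrite -normcM (_ : (c *: f) v - (c *: f) w = c * (f v - f w))// mulrBr.
Qed.

Lemma normc_edgeD f g v w :
  normc ((f + g) v - (f + g) w) <= normc (f v - f w) + normc (g v - g w).
Proof.
rewrite (_ : _ - _ = (f v - f w) + (g v - g w)); first exact: le_normcD.
by rewrite -[(f + g) v]/(f v + g v) -[(f + g) w]/(f w + g w) opprD addrACA.
Qed.

Lemma normc_ge0 (z : R[i]) : 0 <= normc z.
Proof. by case: z => x y; exact: sqrtr_ge0. Qed.

Lemma lipschitz_submod_closed : submod_closed lipschitz.
Proof.
split.
  by apply/lipschitzP; exists 0 => v w _; rewrite subrr normc0.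
move=> c f g /lipschitzP[M fM] /lipschitzP[N gN].
apply/lipschitzP; exists (normc c * M + N) => v w vw.
apply: le_trans (normc_edgeD _ _ _ _) _; rewrite normcZ.
by apply: lerD; [apply: ler_wpM2l; [exact: normc_ge0|exact: fM]|exact: gN].
Qed.

HB.instance Definition _ :=
  GRing.isSubmodClosed.Build _ _ lipschitz lipschitz_submod_closed.

Record lip := Lip { lip_fun :> G -> R[i]; lip_mem : lip_fun \in lipschitz }.

HB.instance Definition _ := [isSub for lip_fun].
HB.instance Definition _ := [Choice of lip by <:].
HB.instance Definition _ := [SubChoice_isSubLmodule of lip by <:].

Lemma edge_exists : exists v w : G, adj v w.
Proof.
have [v _] := infinite_setN0 (@graph_infinite G).
apply: contrapT => noedge; apply: (@graph_infinite G).
suff -> : [set: G] = [set v] by exact: finite_set1.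
apply/seteqP; split => // w _ /=.
have [[|u s] /=] := graph_connected v w; first by [].
by move=> /andP[vu _] _; case: noedge; exists v, u.
Qed.

Lemma lip_has_sup (f : lip) : has_sup (edge_variation f).
Proof.
split; last exact/asboolP/lip_mem.
by have [v [w vw]] := edge_exists; exists (normc (f v - f w)), v, w.
Qed.

Lemma edge_le_sup (f : lip) v w : adj v w ->
  normc (f v - f w) <= sup (edge_variation f).
Proof. by move=> vw; apply: sup_upper_bound (lip_has_sup f) _ _; exists v, w. Qed.

Lemma sup_edge_le (f : lip) M :
  (forall v w, adj v w -> normc (f v - f w) <= M) ->
  sup (edge_variation f) <= M.
Proof.
move=> fM; apply: ge_sup; first by have [] := lip_has_sup f.
by move=> _ [v [w [vw ->]]]; exact: fM.
Qed.

End Lipschitz.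

(* The Lipschitz space normed at the base vertex [a]. The norm of a normed
   module over [R[i]] is [R[i]]-valued, hence the injection [%:C]. *)
Definition lip_at (R : realType) (G : graph) (a : G) : Type := lip R G.

Section LipNorm.
Variables (R : realType) (G : graph) (a : G).

HB.instance Definition _ := GRing.Lmodule.on (lip_at R a).

Let norm (f : lip_at R a) : R[i] := (lip_norm a (f : lip R G))%:C.

Let sup_ge0 (f : lip R G) : 0 <= sup (edge_variation f).
Proof.
have [v [w vw]] := @edge_exists G.
exact: le_trans (normc_ge0 _) (edge_le_sup f vw).
Qed.

Let normD (f g : lip_at R a) : norm (f + g) <= norm f + norm g.
Proof.
rewrite /norm -rmorphD lecR /lip_norm addrACA; apply: lerD.
  exact: le_normcD.
apply: sup_edge_le => v w vw.
apply: le_trans (normc_edgeD _ _ _ _) _.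
by apply: lerD; exact: edge_le_sup.
Qed.

Let sup_edgeZ_le (c : R[i]) (f : lip R G) :
  sup (edge_variation (c *: f : lip R G)) <= normc c * sup (edge_variation f).
Proof.
apply: sup_edge_le => v w vw; rewrite normcZ.
by apply: ler_wpM2l; [exact: normc_ge0|exact: edge_le_sup].
Qed.

Let normZ (c : R[i]) (f : lip_at R a) : norm (c *: f) = `|c| * norm f.
Proof.
rewrite /norm -[`|c|]/((normc c)%:C) -rmorphM; congr (_ %:C).
rewrite /lip_norm mulrDr; congr (_ + _); first exact: normcM.
apply/eqP; rewrite eq_le; apply/andP; split; first exact: sup_edgeZ_le.
have [->|c0] := eqVneq c 0; first by rewrite normc0 mul0r; exact: sup_ge0.
have nc0 : 0 < normc c.
  rewrite lt_neqAle normc_ge0 andbT eq_sym.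
  by apply: contra c0 => /eqP/eq0_normc ->.
rewrite mulrC -ler_pdivlMr// mulrC -normcV.
have := sup_edgeZ_le c^-1 (c *: f : lip R G).
by rewrite scalerA mulVf// scale1r.
Qed.

Let norm0_eq0 (f : lip_at R a) : norm f = 0 -> f = 0.
Proof.
rewrite /norm => -[/eqP]; rewrite /lip_norm.
rewrite paddr_eq0 ?normc_ge0 ?sup_ge0// => /andP[/eqP fa0 /eqP sf0].
have fE v w : adj v w -> f v = f w.
  move=> vw; apply/eqP; rewrite -subr_eq0; apply/eqP/eq0_normc.
  apply/eqP; rewrite eq_le normc_ge0 andbT -sf0; exact: edge_le_sup.
apply: val_inj; apply/funext => w /=.
have [s] := graph_connected a w.
have : f a = 0 by exact: eq0_normc fa0.
elim: s (a) => [|u s ih] v /= fv0; first by move=> _ <-.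
by move=> /andP[vu us] lw; apply: (ih u) => //; rewrite -(fE _ _ vu).
Qed.

HB.instance Definition _ :=
  @Lmodule_isNormed.Build R[i] (lip_at R a) norm normD normZ norm0_eq0.

Lemma lip_atE (f : lip_at R a) : `|f| = (lip_norm a (f : lip R G))%:C.
Proof. by []. Qed.

End LipNorm.

(* Main.v *)
Require Import Defs.
From mathcomp Require Import all_boot all_order all_algebra.
From mathcomp Require Import all_classical all_reals all_analysis.
From mathcomp Require Import lra.

Import Order.TTheory GRing.Theory Num.Theory.
Import numFieldNormedType.Exports.
Import ComplexField.Normc.

Local Open Scope classical_set_scope.
Local Open Scope ring_scope.
Local Open Scope complex_scope.

(** Convergence in norm is reduced to convergence at each vertex. Since the
    graph is connected, a vertex [v] is joined to the base vertex [a] by a path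
    of some length [n], and summing the variations of [f] along that path gives
    [|f v| <= (n + 1) * |f|]: evaluation at a vertex is Lipschitz for the norm
    ([eval_le_lip_norm]). A Cauchy filter is therefore Cauchy at each vertex,
    and completeness of the complex numbers ([normc_cauchy_cvg]) yields a
    pointwise limit [l].

    The constant [n + 1] is unbounded over the graph, so this alone does not
    give convergence in norm. The missing ingredient is that norm bounds pass to
    pointwise limits ([lip_norm_pointwise_le]): every edge involves only two
    vertices, hence each inequality [|f a| + |f v - f w| <= M] survives a
    pointwise limit, with the same [M]. Applied to the differences [g - f], for
    a [g] within [e] of every [f] in some set of the filter, it shows at once
    that [g - l], hence [l], is Lipschitz, and that [l] is within [e] of [g]. *)

(** * The modulus of complex numbers *)

Section Modulus.
Set Implicit Arguments.
Unset Strict Implicit.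
Variable R : realType.
Implicit Types z : R[i].

Lemma normc_Re_le z : `|complex.Re z| <= normc z.
Proof. by case: z => x y /=; rewrite -sqrtr_sqr ler_wsqrtr// lerDl sqr_ge0. Qed.

Lemma normc_Im_le z : `|complex.Im z| <= normc z.
Proof. by case: z => x y /=; rewrite -sqrtr_sqr ler_wsqrtr// lerDr sqr_ge0. Qed.

Lemma normc_le_ReIm z : normc z <= `|complex.Re z| + `|complex.Im z|.
Proof.
case: z => x y /=; rewrite -[leRHS]ger0_norm ?addr_ge0// -sqrtr_sqr ler_wsqrtr//.
by rewrite sqrrD !real_normK ?num_real// lerD2r lerDl mulrn_wge0// mulr_ge0.
Qed.

Lemma normcB (x y : R[i]) : normc (x - y) = normc (y - x).
Proof. by rewrite -[RHS]normcN opprB. Qed.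

Lemma normc_leD (y x z : R[i]) : normc (x - z) <= normc (x - y) + normc (y - z).
Proof. by rewrite (_ : x - z = (x - y) + (y - z)) ?le_normcD// addrA subrK. Qed.

Section Completeness.
Variables (T : Type) (F : set_system T).
Hypothesis FF : ProperFilter F.

Lemma real_cauchy_cvg (u : T -> R) :
  (forall e : R, 0 < e -> exists x : R, \forall t \near F, `|x - u t| < e) ->
  exists x : R, forall e : R, 0 < e -> \forall t \near F, `|x - u t| < e.
Proof.
move=> uF.
have /cauchy_cvg/cvg_ex[x ux] : cauchy (u @ F).
  by apply: cauchy_exP => e /uF[x xu]; exists x; rewrite -ball_normE.
by exists x; move/cvgrPdist_lt: ux.
Qed.

(** The complex numbers are complete for their real-valued modulus: a Cauchy
    filter converges because its real and imaginary parts do. *)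
Lemma normc_cauchy_cvg (u : T -> R[i]) :
  (forall e : R, 0 < e -> exists z, \forall t \near F, normc (z - u t) < e) ->
  exists z, forall e : R, 0 < e -> \forall t \near F, normc (z - u t) < e.
Proof.
move=> uF.
have [x xu] : exists x : R, forall e : R, 0 < e ->
    \forall t \near F, `|x - complex.Re (u t)| < e.
  apply: real_cauchy_cvg => e /uF[z zu]; exists (complex.Re z).
  apply: filterS zu => t; apply: le_lt_trans.
  by have := normc_Re_le (z - u t); case: z (u t) => ? ? [].
have [y yu] : exists y : R, forall e : R, 0 < e ->
    \forall t \near F, `|y - complex.Im (u t)| < e.
  apply: real_cauchy_cvg => e /uF[z zu]; exists (complex.Im z).
  apply: filterS zu => t; apply: le_lt_trans.
  by have := normc_Im_le (z - u t); case: z (u t) => ? ? [].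
exists (x +i* y) => e e0; have e20 : 0 < e / 2 by rewrite divr_gt0.
apply: filterS2 (xu _ e20) (yu _ e20) => t xt yt.
apply: le_lt_trans (normc_le_ReIm _) _; rewrite [e]splitr.
by apply: ltrD; move: xt yt; case: (u t).
Qed.

End Completeness.
End Modulus.

(** * Norm estimates on the Lipschitz space *)

Section Estimates.
Set Implicit Arguments.
Unset Strict Implicit.
Variables (R : realType) (G : graph) (a : G).
Implicit Types f g : lip R G.

Lemma lip_eval_norm_le f : normc (f a) <= lip_norm a f.
Proof.
have [v [w vw]] := edge_exists G.
by rewrite lerDl; exact: le_trans (normc_ge0 _) (edge_le_sup f vw).
Qed.

Lemma lip_edge_norm_le f v w : adj v w ->
  normc (f v - f w) <= lip_norm a f.
Proof.
by move=> vw; apply: le_trans (edge_le_sup f vw) _; rewrite lerDr normc_ge0.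
Qed.

(** The constant is one more than the length of a path from [a] to [v]. *)
Lemma eval_le_lip_norm v :
  exists2 C : R, 0 < C & forall f, normc (f v) <= C * lip_norm a f.
Proof.
have [s] := graph_connected a v.
suff H (u : G) : path (@adj G) u s -> last u s = v -> forall f,
    normc (f v) <= normc (f u) + (size s)%:R * lip_norm a f.
  move=> /H sE /sE fE; exists (size s).+1%:R => // f.
  apply: le_trans (fE f) _.
  by rewrite -nat1r mulrDl mul1r lerD2r lip_eval_norm_le.
elim: s u => [|w s ih] u /=; first by move=> _ <- f; rewrite mul0r addr0.
move=> /andP[uw ws] sv f; apply: le_trans (ih w ws sv f) _.
rewrite -nat1r mulrDl mul1r addrA lerD2r.
have := lip_edge_norm_le f uw; rewrite normcB.
by have := normc_leD (f u) (f w) 0; rewrite !subr0; lra.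
Qed.

Section PointwiseLimit.
Variables (T : Type) (F : set_system T).
Hypothesis FF : ProperFilter F.

(** Lower semicontinuity of the norm under pointwise convergence: the norm is a
    supremum of functions of finitely many values of [f]. *)
Lemma lip_norm_pointwise_le (u : T -> lip R G) (l : G -> R[i]) (M : R) :
  (forall v (e : R), 0 < e -> \forall t \near F, normc (l v - u t v) < e) ->
  (\forall t \near F, lip_norm a (u t) <= M) ->
  exists2 f : lip R G, f = l :> (G -> R[i]) & lip_norm a f <= M.
Proof.
move=> ul uM.
have lM v w : adj v w -> normc (l a) + normc (l v - l w) <= M.
  move=> vw; apply/ler_addgt0Pr => e e0.
  have e30 : 0 < e / 3 by rewrite divr_gt0.
  have [t [tM ta tv tw]] : exists t, [/\ lip_norm a (u t) <= M,
      normc (l a - u t a) < e / 3, normc (l v - u t v) < e / 3 &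
      normc (l w - u t w) < e / 3].
    apply: (@filter_ex _ F); near=> t; split; near: t => //; exact: ul.
  have := normc_leD (u t a) (l a) 0; rewrite !subr0.
  have := normc_leD (u t v) (l v) (l w).
  have := normc_leD (u t w) (u t v) (l w); rewrite (normcB (u t w)).
  have := edge_le_sup (u t) vw; move: tM; rewrite /lip_norm; lra.
have l_lip : l \in @Defs.lipschitz R G.
  apply/lipschitzP; exists M => v w /lM; apply: le_trans.
  by rewrite lerDr normc_ge0.
exists (Lip l_lip) => //; rewrite /lip_norm -lerBrDl.
by apply: sup_edge_le => v w /lM; rewrite lerBrDl.
Unshelve. all: by end_near. Qed.

End PointwiseLimit.
End Estimates.

(** * Completeness *)

Theorem proposition2p5 (R : realType) (G : graph) (a : G) :
  forall F : set_system (lip_at R a),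
    ProperFilter F -> cauchy F -> cvg F.
Proof.
move=> F FF /cauchyP Fc.
have Fnorm (e : R) : 0 < e ->
    exists g : lip R G, \forall f \near F, lip_norm a (g - f : lip R G) < e.
  move=> e0; have [|g gF] := Fc e%:C; first by rewrite ltcR.
  by exists g; apply: filterS gF => f; rewrite -ball_normE /= lip_atE ltcR.
have /choice[l lF] v : exists z, forall e : R, 0 < e ->
    \forall f \near F, normc (z - (f : lip R G) v) < e.
  have [C C0 Cv] := @eval_le_lip_norm R G a v.
  apply: normc_cauchy_cvg => e e0.
  have [|g gF] := Fnorm (e / C); first by rewrite divr_gt0.
  exists (g v); apply: filterS gF => f; rewrite ltr_pdivlMr// mulrC.
  exact: le_lt_trans (Cv (g - f : lip R G)).
(* By linearity [g - f] converges pointwise to [g - l] as [f] runs along [F]. *)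
have l_near (e : R) (g : lip R G) :
    (\forall f \near F, lip_norm a (g - f : lip R G) < e) ->
    exists2 h : lip R G, h = (fun v => g v - l v) :> (G -> R[i]) &
      lip_norm a h <= e.
  move=> gF.
  apply: (@lip_norm_pointwise_le _ _ _ _ F FF (fun f => g - f : lip R G)).
    move=> v d /(lF v); apply: filterS => f.
    rewrite (_ : _ - (_ - _ : lip R G) v = f v - l v); first by rewrite normcB.
    by rewrite -[(g - f : lip R G) v]/(g v - f v) opprB addrC addrA subrK.
  by apply: filterS gF => f /ltW.
have [L Ll] : exists L : lip R G, L = l :> (G -> R[i]).
  have [g /l_near[h hE _]] := Fnorm 1 ltr01; exists (g - h : lip R G).
  apply/funext => v; rewrite -[LHS]/(g v - h v) hE.
  by rewrite opprB addrC subrK.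
(* The norm takes values in [R[i]], whose positive elements are the positive
   reals; hence the decomposition of the radius. *)
apply/cvg_ex; exists (L : lip_at R a); apply/fcvgrPdist_lt => -[e e'].
rewrite ltcE /= => /andP[/eqP -> e0].
have e20 : 0 < e / 2 by rewrite divr_gt0.
have [g gF] := Fnorm _ e20; have [h hE he] := l_near _ _ gF.
apply: filterS gF => f gf.
have -> : (L : lip_at R a) - f = (g - f : lip_at R a) - (h : lip_at R a).
  apply: val_inj; apply/funext => v; rewrite -[LHS]/(L v - f v).
  rewrite -[RHS]/(g v - f v - h v) hE Ll.
  by rewrite opprB [RHS]addrC addrA subrK.
apply: le_lt_trans (ler_normB _ _) _.
by rewrite !lip_atE -rmorphD ltcR; move: he gf; lra.
Qed.
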